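(* Let $B_1,\dots,B_m$ be real symmetric $n\times n$ matrices. Then $$\sum_{r,s=1}^m\|[B_r,B_s]\|^2\leq \Big(\sum_{r=1}^m\|B_r\|^2\Big)^2 .$$ Moreover (for $m\ge 2$ and $n\ge 2$), equality holds if and only if there exists an orthogonal $m\times m$ matrix $R=(R_{rs})$ such that, among the rotated matrices $\tilde B_r:=\sum_{s=1}^m R_{sr}B_s$, $1\le r\le m$, all are zero except two matrices, and these two can be written as $$P\begin{pmatrix}0&\mu&0&\cdots&0\\ \mu&0&0&\cdots&0\\ 0&0&0&\cdots&0\\ \vdots&\vdots&\vdots&\ddots&\vdots\\ 0&0&0&\cdots&0\end{pmatrix}P^t,\qquad P\begin{pmatrix}\mu&0&0&\cdots&0\\ 0&-\mu&0&\cdots&0\\ 0&0&0&\cdots&0\\ \vdots&\vdots&\vdots&\ddots&\vdots\\ 0&0&0&\cdots&0\end{pmatrix}P^t$$ for some orthogonal $n\times n$ matrix $P$ and some real number $\mu$ (the same $P$ and $\mu$ for both; $\mu=0$ is allowed).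
   Context: For a real matrix $A$, $\|A\|^2$ denotes the sum of the squares of the entries of $A$. For square matrices $A,B$ of the same size, $[A,B]=AB-BA$. The superscript $t$ denotes transpose. *)

(* Defs.v *)
From mathcomp Require Import all_boot all_order all_algebra.
From mathcomp Require Import reals.

Set Implicit Arguments.
Unset Strict Implicit.
Unset Printing Implicit Defensive.

Import GRing.Theory Num.Theory.

Local Open Scope ring_scope.

(* The matrix norm of MathComp-Analysis is the sup norm, hence this one. *)
Definition sqfrob (R : realType) (m n : nat) (A : 'M[R]_(m, n)) : R :=
  \sum_(i < m) \sum_(j < n) A i j ^+ 2.

Definition commmx (R : realType) (n : nat) (A B : 'M[R]_n) : 'M[R]_n :=
  A *m B - B *m A.

(* [unitarymx] in MathComp requires a [numClosedFieldType] of coefficients. *)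
Definition orthogonal_mx (R : realType) (n : nat) (Q : 'M[R]_n) : Prop :=
  Q *m Q^T = 1%:M /\ Q^T *m Q = 1%:M.

(* Rows and columns are numbered from 0. *)
Definition offdiag_block (R : realType) (n : nat) (mu : R) : 'M[R]_n :=
  \matrix_(i < n, j < n)
    if ((i == 0%N :> nat) && (j == 1%N :> nat))
       || ((i == 1%N :> nat) && (j == 0%N :> nat)) then mu else 0.

Definition diag_block (R : realType) (n : nat) (mu : R) : 'M[R]_n :=
  \matrix_(i < n, j < n)
    if (i == 0%N :> nat) && (j == 0%N :> nat) then mu
    else if (i == 1%N :> nat) && (j == 1%N :> nat) then - mu else 0.

Definition rotated (R : realType) (m n : nat) (Q : 'M[R]_m)
    (B : 'I_m -> 'M[R]_n) (r : 'I_m) : 'M[R]_n :=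
  \sum_(s < m) Q s r *: B s.

(* Main.v *)
Require Import Defs.
From mathcomp Require Import all_boot all_order all_algebra.
From mathcomp Require Import fingroup perm reals complex ring lra.

(** The commutator norms and the squared norms are unchanged when the family
    [B] is rotated ([sum_sqfrob_commmx_rotated], [sum_sqfrob_rotated]), and a
    rotation that diagonalises the Gram matrix makes the family orthogonal for the
    Frobenius product ([rotated_orthogonal]). Write [x r] for the squared norm of
    the r-th matrix, and [c r s] for the squared norm of the commutator of the
    normalised r-th and s-th matrices.

    The heart of the matter is a bound on each row of [c]: the excesses
    [max 0 (c r s - 1)] have sum at most 1 over [s] ([sum_excess_commmx_le1]).
    To see it, diagonalise the r-th matrix, with eigenvalues [e i] of total square
    1. Commuting with it multiplies the entry [(i, j)] by [e i - e j], so by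
    Bessel's inequality the sum of the excesses is at most the sum of
    [max 0 ((e i - e j)^2 - 1)] over the pairs [i < j]. The pairs contributing to
    it are the edges of a star: two disjoint edges would need a total square
    above 1, and so would a triangle ([large_gaps_star]). On a star with [k] leaves
    the sum of the [(e i - e j)^2] is at most [k + 1] by Cauchy-Schwarz, which is
    the claim ([star_gaps_defect], [sum_excess_gaps_le2]).

    The identity [double_sum_defect] writes the square of the sum of the [x r],
    minus the double sum of the [x r * x s * c r s], as a sum of terms that the row
    bound makes nonnegative; this is the inequality.

    In the case of equality all these terms vanish. For nonzero matrices every row
    has total excess 1, every [c r s] with [r <> s] is at least 1, and [x r = x s]
    when [c r s > 1]. Equality in the row bound determines the eigenvalues up to
    one scale, [(- k, 1, ..., 1, 0, ..., 0)], and confines the other matrices to the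
    edges of the star. Two orthogonal unit matrices confined in this way have a
    commutator of squared norm 1/2 < 1 ([sqfrob_commmx_cross_mx]), so only one
    other matrix survives, and then [k = 1]: this is the pair of the statement
    ([equality_configuration]). *)

Set Implicit Arguments.
Unset Strict Implicit.
Unset Printing Implicit Defensive.

Import Order.TTheory GRing.Theory Num.Theory.

Local Open Scope ring_scope.

(** * The real spectral theorem *)

Lemma symmetricmx_tr (R : realType) (n : nat) (A : 'M[R]_n) :
  A \is symmetricmx -> A^T = A.
Proof.
move=> Asym; have := trmx_hermitian (HermitianMx Asym).
by rewrite /= scale1r map_mx_id.
Qed.

Lemma orthogonal_mxP (R : realType) (n : nat) (Q : 'M[R]_n) :
  Q *m Q^T = 1%:M -> orthogonal_mx Q.
Proof. by move=> QQt; split=> //; apply: mulmx1C. Qed.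

Lemma sum_sqr_row_gt0 (R : realType) (n : nat) (v : 'rV[R]_n) :
  v != 0 -> 0 < \sum_j v 0 j ^+ 2.
Proof.
move=> v_neq0; have sq_ge0 j : true -> 0 <= v 0 j ^+ 2 by rewrite sqr_ge0.
rewrite lt_neqAle sumr_ge0 // andbT eq_sym; apply: contra_neq v_neq0 => v0.
apply/rowP => j; rewrite [RHS]mxE; apply/eqP; rewrite -sqrf_eq0.
by rewrite (psumr_eq0P sq_ge0 v0).
Qed.

(** Over [R[i]] the matrix is hermitian, so its spectral diagonal is real, and a
    real root of the characteristic polynomial is already a root over [R]. *)
Lemma symmetricmx_eigenvalue (R : realType) (n : nat) (A : 'M[R]_n.+1) :
  A^T = A -> exists a, eigenvalue A a.
Proof.
move=> symA; pose AC := map_mx (real_complex R) A.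
have hermAC : AC \is hermsymmx.
  apply: realsym_hermsym.
    by apply/is_hermitianmxP; rewrite /= scale1r map_mx_id // /AC map_trmx symA.
  by apply/mxOverP => i j; rewrite mxE; apply/complex_realP; exists (A i j).
have /hermitian_normalmx/orthomx_spectralP eqAC := hermAC.
have unitP := spectral_unit AC.
have /mxOverP/(_ ord0 ord0)/complex_realP[a da] :=
  hermitian_spectral_diag_real hermAC.
exists a; rewrite eigenvalue_root_char -(fmorph_root (real_complex R)).
rewrite map_char_poly -/AC -eigenvalue_root_char.
apply/eigenvalueP; exists (row ord0 (spectralmx AC)).
  rewrite -row_mul {2}eqAC !mulmxA mulmxV // mul1mx row_mul row_diag_mx da.
  by rewrite -scalemxAl -rowE.
apply: contraTneq unitP => row0.
rewrite -row_free_unit -kermx_eq0; apply/negP => /eqP ker0.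
have : ((delta_mx 0 ord0 : 'rV_n.+1) <= kermx (spectralmx AC))%MS.
  by apply/sub_kermxP; rewrite -rowE.
rewrite ker0 submx0 => /eqP/matrixP/(_ 0 ord0).
by rewrite !mxE !eqxx => /eqP; rewrite oner_eq0.
Qed.

(** The matrix is the reflection exchanging the first basis vector [e] and [v];
    its mirror is orthogonal to [u = v - e], and when [u] vanishes the identity
    does the same job. *)
Lemma orthogonal_mx_completion (R : realType) (n : nat) (v : 'rV[R]_n.+1) :
  v *m v^T = 1%:M -> exists2 H, orthogonal_mx H & row ord0 H = v.
Proof.
move=> vv; pose e : 'rV[R]_n.+1 := delta_mx 0 ord0.
have ee : e *m e^T = 1%:M.
  by rewrite trmx_delta mul_delta_mx; apply/matrixP=> i j; rewrite !ord1 !mxE.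
pose u := v - e.
have scal (x : 'M[R]_1) : x = (x 0 0)%:M by rewrite [LHS]mx11_scalar.
have [u0|u_neq0] := eqVneq u 0.
  exists 1%:M; first by apply: orthogonal_mxP; rewrite trmx1 mulmx1.
  by rewrite row1 -/e; apply/esym/eqP; rewrite -subr_eq0 -/u u0.
pose q := (u *m u^T) 0 0.
have uu : u *m u^T = q%:M by apply: scal.
have qE : q = \sum_j u 0 j ^+ 2.
  by rewrite /q mxE; apply: eq_bigr => j _; rewrite [u^T _ _]mxE expr2.
have q_neq0 : q != 0 by rewrite qE gt_eqF // sum_sqr_row_gt0.
pose H := 1%:M - (2 / q) *: (u^T *m u).
have Ht : H^T = H by rewrite /H linearB linearZ /= trmx1 trmx_mul trmxK.
have Hu : u *m H = - u.
  rewrite /H mulmxBr mulmx1 -scalemxAr mulmxA uu mul_scalar_mx scalerA.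
  rewrite divfK // scaler_nat mulr2n opprD addrA subrr sub0r //.
exists H.
  apply: orthogonal_mxP; rewrite Ht {1}/H mulmxBl mul1mx -scalemxAl -mulmxA Hu.
  by rewrite mulmxN scalerN opprK /H subrK.
rewrite rowE -/e.
have eu : 2 *: (e *m u^T) = - q%:M.
  rewrite -uu /u linearB /= !mulmxBl !mulmxBr ee vv.
  have -> : e *m v^T = v *m e^T.
    by rewrite (scal (v *m e^T)) -tr_scalar_mx -scal trmx_mul trmxK.
  by rewrite scaler_nat mulr2n -[1%:M - v *m e^T]opprB -opprD opprK.
rewrite /H mulmxBr mulmx1 -scalemxAr mulmxA mulrC -scalerA scalemxAl eu.
by rewrite mulNmx mul_scalar_mx scalerN scalerA mulVf // scale1r opprK addrC subrK.
Qed.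

(** Induction on the size: a reflection sending the first basis vector to a unit
    eigenvector conjugates [A] to a block matrix whose first row is diagonal, and
    by symmetry its first column is diagonal as well. *)
Lemma symmetricmx_spectral (R : realType) (n : nat) (A : 'M[R]_n) :
  A^T = A ->
  exists P d, orthogonal_mx P /\ A = P *m diag_mx d *m P^T.
Proof.
elim: n A => [|n IHn] A symA.
  exists 1%:M, 0; split; first by apply: orthogonal_mxP; rewrite trmx1 mulmx1.
  by apply/matrixP; case.
have [a /eigenvalueP[w wA w_neq0]] := symmetricmx_eigenvalue symA.
pose q := \sum_j w 0 j ^+ 2.
have q_gt0 : 0 < q by apply: sum_sqr_row_gt0.
pose v := (Num.sqrt q)^-1 *: w.
have vA : v *m A = a *: v by rewrite /v -scalemxAl wA !scalerA mulrC.
have vv : v *m v^T = 1%:M.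
  have ww : w *m w^T = q%:M.
    rewrite [LHS]mx11_scalar mxE; congr (_%:M).
    by apply: eq_bigr => j _; rewrite [w^T _ _]mxE expr2.
  rewrite /v linearZ /= -scalemxAl -scalemxAr ww scalerA -invfM -expr2.
  by rewrite sqr_sqrtr ?ltW // scale_scalar_mx mulVf // gt_eqF.
have [H [HHt HtH] rowH] := orthogonal_mx_completion vv.
have [M defM] : exists M : 'M[R]_(1 + n), M = H *m A *m H^T by eexists.
have symM : M^T = M by rewrite defM !trmx_mul trmxK symA mulmxA.
have rowM j : M ord0 j = (a *: delta_mx ord0 ord0 : 'M_n.+1) ord0 j.
  have : row ord0 M = a *: delta_mx 0 ord0.
    by rewrite defM !row_mul rowH vA -scalemxAl -rowH -row_mul HHt row1.
  by move/rowP/(_ j); rewrite !mxE !eqxx.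
have symD : (drsubmx M)^T = drsubmx M by rewrite trmx_drsub symM.
have [P [d [[PPt PtP] eqM]]] := IHn _ symD.
have eM : M = block_mx a%:M 0 0 (P *m diag_mx d *m P^T).
  rewrite -[M in LHS]submxK -eqM; congr block_mx.
  - by apply/matrixP => i j; rewrite !ord1 !mxE lshift0 rowM !mxE eqxx mulr1.
  - by apply/matrixP => i j; rewrite !ord1 !mxE lshift0 rowM !mxE mulr0.
  - apply/matrixP => i j; rewrite !ord1 !mxE lshift0 -symM mxE rowM !mxE.
    by rewrite mulr0.
pose K : 'M[R]_(1 + n) := block_mx 1%:M 0 0 P.
have Kt : K^T = block_mx 1%:M 0 0 P^T by rewrite tr_block_mx !trmx0 trmx1.
have KK : K *m K^T = 1%:M.
  rewrite Kt mulmx_block !mulmx0 !mul0mx !addr0 !add0r mulmx1 PPt.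
  by rewrite -scalar_mx_block.
have KM : K *m diag_mx (row_mx a%:M d) *m K^T = M.
  have -> : row_mx a%:M d = row_mx (const_mx a : 'rV_1) d.
    by congr row_mx; apply/rowP => i; rewrite !ord1 !mxE eqxx.
  rewrite diag_mx_row diag_const_mx Kt !mulmx_block !mulmx0 !mul0mx.
  by rewrite !addr0 !add0r !mul0mx !mul1mx !mulmx1 eM.
exists (H^T *m K), (row_mx a%:M d : 'rV_(1 + n)).
split.
  apply: orthogonal_mxP; rewrite trmx_mul trmxK mulmxA -(mulmxA _ K).
  by rewrite (KK : _ = 1%:M :> 'M_n.+1) mulmx1.
rewrite trmx_mul trmxK !mulmxA -(mulmxA _ K) -(mulmxA _ _ K^T).
rewrite (KM : _ = _ :> 'M_n.+1) defM.
by rewrite !mulmxA HtH mul1mx -mulmxA HtH mulmx1.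
Qed.

(** * The Frobenius inner product *)

Definition frobdot (R : realType) (n : nat) (A B : 'M[R]_n) : R :=
  \sum_(i < n) \sum_(j < n) A i j * B i j.

Lemma frobdotE (R : realType) (n : nat) (A B : 'M[R]_n) :
  frobdot A B = \tr (A *m B^T).
Proof.
rewrite /mxtrace; apply: eq_bigr => i _; rewrite [RHS]mxE.
by apply: eq_bigr => j _; rewrite [B^T _ _]mxE.
Qed.

Lemma frobdotxx (R : realType) (n : nat) (A : 'M[R]_n) :
  frobdot A A = sqfrob A.
Proof. by apply: eq_bigr => i _; apply: eq_bigr => j _; rewrite expr2. Qed.

Lemma frobdotC (R : realType) (n : nat) (A B : 'M[R]_n) :
  frobdot A B = frobdot B A.
Proof. by apply: eq_bigr => i _; apply: eq_bigr => j _; rewrite mulrC. Qed.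

Lemma frobdotZ (R : realType) (n : nat) (a b : R) (A B : 'M[R]_n) :
  frobdot (a *: A) (b *: B) = a * b * frobdot A B.
Proof.
rewrite mulr_sumr; apply: eq_bigr => i _; rewrite mulr_sumr.
by apply: eq_bigr => j _; rewrite !mxE mulrACA.
Qed.

Lemma frobdot_suml (R : realType) (m n : nat) (a : 'I_m -> R)
    (A : 'I_m -> 'M[R]_n) (B : 'M[R]_n) :
  frobdot (\sum_s a s *: A s) B = \sum_s a s * frobdot (A s) B.
Proof.
rewrite frobdotE mulmx_suml raddf_sum /=; apply: eq_bigr => s _.
by rewrite -scalemxAl linearZ frobdotE.
Qed.

Lemma frobdot_sumr (R : realType) (m n : nat) (a : 'I_m -> R)
    (A : 'M[R]_n) (B : 'I_m -> 'M[R]_n) :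
  frobdot A (\sum_s a s *: B s) = \sum_s a s * frobdot A (B s).
Proof.
by rewrite frobdotC frobdot_suml; apply: eq_bigr => s _; rewrite frobdotC.
Qed.

Lemma frobdot_conj (R : realType) (n : nat) (P A B : 'M[R]_n) :
  orthogonal_mx P -> frobdot (P^T *m A *m P) (P^T *m B *m P) = frobdot A B.
Proof.
case=> PPt _; rewrite !frobdotE !trmx_mul trmxK !mulmxA -(mulmxA _ P) PPt mulmx1.
by rewrite mxtrace_mulC !mulmxA PPt mul1mx.
Qed.

Lemma sqfrob_conj (R : realType) (n : nat) (P A : 'M[R]_n) :
  orthogonal_mx P -> sqfrob (P^T *m A *m P) = sqfrob A.
Proof. by move=> orthP; rewrite -!frobdotxx frobdot_conj. Qed.

Lemma sqfrob_ge0 (R : realType) (n : nat) (A : 'M[R]_n) : 0 <= sqfrob A.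
Proof. by apply: sumr_ge0 => i _; apply: sumr_ge0 => j _; apply: sqr_ge0. Qed.

Lemma sqfrob_eq0 (R : realType) (n : nat) (A : 'M[R]_n) :
  (sqfrob A == 0) = (A == 0).
Proof.
apply/eqP/eqP => [A0|->]; last first.
  by apply: big1 => i _; apply: big1 => j _; rewrite mxE expr0n.
apply/matrixP => i j; rewrite mxE; apply/eqP; rewrite -sqrf_eq0.
have row0 := psumr_eq0P (fun i _ => sumr_ge0 _ (fun j _ => sqr_ge0 (A i j))) A0.
by rewrite (psumr_eq0P (fun j _ => sqr_ge0 (A i j)) (row0 i isT)).
Qed.

Lemma sqfrobZ (R : realType) (n : nat) (a : R) (A : 'M[R]_n) :
  sqfrob (a *: A) = a ^+ 2 * sqfrob A.
Proof. by rewrite -!frobdotxx frobdotZ expr2. Qed.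

Lemma commmx_conj (R : realType) (n : nat) (P A B : 'M[R]_n) :
  orthogonal_mx P ->
  commmx (P^T *m A *m P) (P^T *m B *m P) = P^T *m commmx A B *m P.
Proof.
case=> PPt _; have mul X Y : P^T *m X *m P *m (P^T *m Y *m P) = P^T *m (X *m Y) *m P.
  by rewrite !mulmxA -(mulmxA _ P) PPt mulmx1.
by rewrite /commmx !mul mulmxBr mulmxBl.
Qed.

Lemma sqfrob_commmx_conj (R : realType) (n : nat) (P A B : 'M[R]_n) :
  orthogonal_mx P ->
  sqfrob (commmx (P^T *m A *m P) (P^T *m B *m P)) = sqfrob (commmx A B).
Proof. by move=> orthP; rewrite commmx_conj // sqfrob_conj. Qed.

Lemma commmxZ (R : realType) (n : nat) (a b : R) (A B : 'M[R]_n) :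
  commmx (a *: A) (b *: B) = (a * b) *: commmx A B.
Proof.
by rewrite /commmx -!scalemxAl -!scalemxAr !scalerA (mulrC b) scalerBr.
Qed.

Lemma commmxN (R : realType) (n : nat) (A B : 'M[R]_n) :
  commmx A B = - commmx B A.
Proof. by rewrite opprB. Qed.

Lemma commmxx (R : realType) (n : nat) (A : 'M[R]_n) : commmx A A = 0.
Proof. exact: subrr. Qed.

Lemma sqfrob_commmxC (R : realType) (n : nat) (A B : 'M[R]_n) :
  sqfrob (commmx A B) = sqfrob (commmx B A).
Proof. by rewrite commmxN -scaleN1r sqfrobZ sqrrN expr1n mul1r. Qed.

Lemma commmx_rotatedr (R : realType) (m n : nat) (Q : 'M[R]_m)
    (A : 'M[R]_n) (B : 'I_m -> 'M[R]_n) (r : 'I_m) :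
  commmx A (rotated Q B r) = rotated Q (fun s => commmx A (B s)) r.
Proof.
rewrite /commmx /rotated mulmx_sumr mulmx_suml -sumrB; apply: eq_bigr => s _.
by rewrite -scalemxAr -scalemxAl scalerBr.
Qed.

(** * Invariance under rotations of the family *)

Lemma rotated_tr (R : realType) (m n : nat) (Q : 'M[R]_m)
    (B : 'I_m -> 'M[R]_n) (symB : forall r, (B r)^T = B r) (r : 'I_m) :
  (rotated Q B r)^T = rotated Q B r.
Proof.
by rewrite linear_sum; apply: eq_bigr => s _; rewrite linearZ /= symB.
Qed.

Lemma frobdot_rotated (R : realType) (m n : nat) (Q : 'M[R]_m)
    (B : 'I_m -> 'M[R]_n) (r s : 'I_m) :
  frobdot (rotated Q B r) (rotated Q B s) =
  (Q^T *m (\matrix_(i, j) frobdot (B i) (B j)) *m Q) r s.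
Proof.
rewrite frobdot_sumr mxE; apply: eq_bigr => j _; rewrite mulrC; congr (_ * _).
by rewrite frobdot_suml mxE; apply: eq_bigr => i _; rewrite !mxE.
Qed.

(** The sum is the trace of the Gram matrix. *)
Lemma sum_sqfrob_rotated (R : realType) (m n : nat) (Q : 'M[R]_m)
    (B : 'I_m -> 'M[R]_n) :
  orthogonal_mx Q -> \sum_r sqfrob (rotated Q B r) = \sum_r sqfrob (B r).
Proof.
case=> QQt _; pose G := \matrix_(i, j) frobdot (B i) (B j).
have trG : \tr G = \sum_r sqfrob (B r).
  by apply: eq_bigr => r _; rewrite mxE frobdotxx.
rewrite -trG -[G in RHS]mulmx1 -QQt mulmxA mxtrace_mulC mulmxA.
by apply: eq_bigr => r _; rewrite -frobdotxx frobdot_rotated.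
Qed.

(** Since the commutator is linear in each argument, rotating one of its two
    slots rotates a family of matrices, whose sum of squared norms is unchanged;
    this is done for one slot and then for the other. *)
Lemma sum_sqfrob_commmx_rotated (R : realType) (m n : nat) (Q : 'M[R]_m)
    (B : 'I_m -> 'M[R]_n) :
  orthogonal_mx Q ->
  \sum_r \sum_s sqfrob (commmx (rotated Q B r) (rotated Q B s)) =
  \sum_r \sum_s sqfrob (commmx (B r) (B s)).
Proof.
move=> orthQ.
have inner (A : 'M[R]_n) : \sum_s sqfrob (commmx A (rotated Q B s)) =
    \sum_s sqfrob (commmx A (B s)).
  rewrite -[RHS](sum_sqfrob_rotated _ orthQ).
  by apply: eq_bigr => s _; rewrite commmx_rotatedr.
rewrite (eq_bigr _ (fun r _ => inner _)) exchange_big [RHS]exchange_big /=.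
apply: eq_bigr => s _.
under eq_bigr do rewrite sqfrob_commmxC.
by rewrite inner; apply: eq_bigr => r _; rewrite sqfrob_commmxC.
Qed.

(** The Gram matrix changes by congruence, so an orthogonal matrix that diagonalises
    it is a suitable rotation. *)
Lemma rotated_orthogonal (R : realType) (m n : nat) (B : 'I_m -> 'M[R]_n) :
  exists2 Q, orthogonal_mx Q &
    forall r s, r != s -> frobdot (rotated Q B r) (rotated Q B s) = 0.
Proof.
pose G := \matrix_(i, j) frobdot (B i) (B j).
have symG : G^T = G by apply/matrixP => i j; rewrite !mxE frobdotC.
have [Q [d [[QQt QtQ] eqG]]] := symmetricmx_spectral symG.
exists Q => // r s neq_rs; rewrite frobdot_rotated -/G eqG !mulmxA QtQ mul1mx.
by rewrite -mulmxA QtQ mulmx1 mxE (negPf neq_rs) mulr0n.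
Qed.

(** * Large gaps in a unit vector *)

(** The part of a squared commutator norm above the generic value 1. *)
Definition excess (R : realType) (c : R) : R := Num.max 0 (c - 1).

Lemma excess_ge0 (R : realType) (c : R) : 0 <= excess c.
Proof. by rewrite /excess le_max lexx. Qed.

Lemma ge_excess (R : realType) (c : R) : c - 1 <= excess c.
Proof. by rewrite /excess le_max lexx orbT. Qed.

Lemma excess_le1 (R : realType) (c : R) : c <= 1 -> excess c = 0.
Proof. by move=> c1; apply/max_idPl; rewrite subr_le0. Qed.

Lemma excess_ge1 (R : realType) (c : R) : 1 <= c -> excess c = c - 1.
Proof. by move=> c1; apply/max_idPr; rewrite subr_ge0. Qed.

Lemma excess_gt0 (R : realType) (c : R) : (0 < excess c) = (1 < c).
Proof. by rewrite /excess lt_max ltxx subr_gt0. Qed.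

Lemma sum_uniq_le (R : realType) (I : finType) (s : seq I) (f : I -> R) :
  uniq s -> (forall i, 0 <= f i) -> \sum_(i <- s) f i <= \sum_i f i.
Proof.
move=> uniq_s f_ge0; rewrite big_uniq // [leRHS](bigID (mem s)) /= lerDl.
by apply: sumr_ge0 => i _; apply: f_ge0.
Qed.

(** As [(a - b)^2 <= 2 (a^2 + b^2)], a pair of coordinates with a gap above 1
    uses more than half of the squared norm, which leaves no room for a disjoint
    pair of the same kind. *)
Lemma large_gaps_meet (R : realType) (n : nat) (x : 'I_n -> R) (i j k l : 'I_n) :
  \sum_i x i ^+ 2 <= 1 -> 1 < (x i - x j) ^+ 2 -> 1 < (x k - x l) ^+ 2 ->
  [|| k == i, k == j, l == i | l == j].
Proof.
move=> x_le1 ij kl.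
have neq_ij : i != j.
  by apply: contraTneq ij => ->; rewrite subrr expr0n -leNgt ler01.
have neq_kl : k != l.
  by apply: contraTneq kl => ->; rewrite subrr expr0n -leNgt ler01.
apply: contraT; rewrite !negb_or => /and4P[ki kj li lj].
have : \sum_(p <- [:: i; j; k; l]) x p ^+ 2 <= \sum_p x p ^+ 2.
  apply: sum_uniq_le => [|p]; last exact: sqr_ge0.
  by rewrite /= !inE !negb_or neq_ij neq_kl ![i == _]eq_sym ![j == _]eq_sym ki kj li lj.
rewrite !big_cons big_nil addr0 => x4.
have sq (a b : R) : (a - b) ^+ 2 <= 2 * (a ^+ 2 + b ^+ 2).
  by rewrite -subr_ge0; have := sqr_ge0 (a + b); congr (_ <= _); ring.
have := sq (x i) (x j); have := sq (x k) (x l).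
lra.
Qed.

Lemma large_gaps_no_triangle (R : realType) (a b c : R) :
  1 < (a - b) ^+ 2 -> 1 < (b - c) ^+ 2 -> 1 < (c - a) ^+ 2 ->
  1 < a ^+ 2 + b ^+ 2 + c ^+ 2.
Proof. by move=> ab bc ca; have := sqr_ge0 (a + b + c); nra. Qed.

(** Draw an edge between two indices when their coordinates have a gap above 1.
    Any two edges meet and there is no triangle, so the graph is a star. *)
Lemma large_gaps_star (R : realType) (n : nat) (x : 'I_n -> R) (i0 j0 : 'I_n) :
  \sum_i x i ^+ 2 <= 1 -> 1 < (x i0 - x j0) ^+ 2 ->
  exists c, forall i j, 1 < (x i - x j) ^+ 2 -> (i == c) || (j == c).
Proof.
move=> x_le1 gap0.
have gapC i j : 1 < (x i - x j) ^+ 2 -> 1 < (x j - x i) ^+ 2.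
  by rewrite -opprB sqrrN.
have gap_neq i j : 1 < (x i - x j) ^+ 2 -> i != j.
  by apply: contraTneq => ->; rewrite subrr expr0n -leNgt ler01.
have no_triangle i j k : 1 < (x i - x j) ^+ 2 -> 1 < (x j - x k) ^+ 2 ->
    1 < (x k - x i) ^+ 2 -> False.
  move=> ij jk ki; have := large_gaps_no_triangle ij jk ki.
  have : \sum_(p <- [:: i; j; k]) x p ^+ 2 <= \sum_p x p ^+ 2.
    apply: sum_uniq_le => [|p]; last exact: sqr_ge0.
    by rewrite /= !inE negb_or (gap_neq _ _ ij) (gap_neq _ _ jk) eq_sym gap_neq.
  rewrite !big_cons big_nil addr0 => *; lra.
pose away c := [pred p : 'I_n * 'I_n |
  [&& 1 < (x p.1 - x p.2) ^+ 2, p.1 != c & p.2 != c]].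
have awayP c : (forall p, ~~ away c p) ->
    forall i j, 1 < (x i - x j) ^+ 2 -> (i == c) || (j == c).
  by move=> naway i j ij; have := naway (i, j); rewrite /= ij /= negb_and !negbK.
have [away_i|] := pickP (away i0); last first.
  by move=> naway; exists i0; apply: awayP => p; rewrite naway.
case: away_i => k l /= /and3P[kl k_i0 l_i0].
(* The gap missing [i0] has the form [j0], [k]. *)
have {k l kl k_i0 l_i0}[k gapk k_i0] : exists2 k, 1 < (x j0 - x k) ^+ 2 & k != i0.
  have := large_gaps_meet x_le1 gap0 kl.
  rewrite (negPf k_i0) (negPf l_i0) /= => /orP[]/eqP eq_j0.
    by exists l; rewrite -?eq_j0.
  by exists k; rewrite -?eq_j0 // gapC.
have [away_j|] := pickP (away j0); last first.
  by move=> naway; exists j0; apply: awayP => p; rewrite naway.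
case: away_j => p q /= /and3P[pq p_j0 q_j0].
have := large_gaps_meet x_le1 gap0 pq.
have := large_gaps_meet x_le1 gapk pq.
rewrite (negPf p_j0) (negPf q_j0) /= !orbF.
case/orP=> /eqP E1; case/orP=> /eqP E2; subst.
- by rewrite eqxx in k_i0.
- by case: (no_triangle _ _ _ gap0 gapk pq).
- by case: (no_triangle _ _ _ gap0 gapk (gapC _ _ pq)).
- by rewrite eqxx in k_i0.
Qed.

(** Lagrange's form of the Cauchy-Schwarz remainder for the constant vector. *)
Lemma sum_sqr_gaps (R : realType) (I : finType) (J : {pred I}) (x : I -> R) :
  \sum_(i in J) \sum_(j in J) (x i - x j) ^+ 2 =
  2 * (#|J|%:R * (\sum_(j in J) x j ^+ 2) - (\sum_(j in J) x j) ^+ 2).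
Proof.
have -> : \sum_(i in J) \sum_(j in J) (x i - x j) ^+ 2 =
    \sum_(i in J) (#|J|%:R * x i ^+ 2 + \sum_(j in J) x j ^+ 2
                   - 2 * (x i * \sum_(j in J) x j)).
  apply: eq_bigr => i _.
  rewrite mulr_natl -sumr_const mulr_sumr mulr_sumr -sumrN -!big_split /=.
  by apply: eq_bigr => j _; ring.
rewrite sumrB big_split /= sumr_const -!mulr_sumr -mulr_suml; ring.
Qed.

(** The Laplacian of a star with [#|J|] leaves has largest eigenvalue [#|J| + 1].
    Writing the defect as a sum of squares also gives the equality case: all
    leaves have the same value, and the coordinates of the star sum to 0. *)
Lemma star_gaps_defect (R : realType) (I : finType) (J : {set I}) (c : I)
    (x : I -> R) :
  1 - \sum_(j in J) ((x c - x j) ^+ 2 - 1) =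
  (#|J|%:R + 1) * (1 - (x c ^+ 2 + \sum_(j in J) x j ^+ 2))
  + (x c + \sum_(j in J) x j) ^+ 2
  + (\sum_(i in J) \sum_(j in J) (x i - x j) ^+ 2) / 2.
Proof.
rewrite sum_sqr_gaps.
have -> : \sum_(j in J) ((x c - x j) ^+ 2 - 1) =
    #|J|%:R * (x c ^+ 2 - 1) + \sum_(j in J) x j ^+ 2
    - 2 * (x c * \sum_(j in J) x j).
  rewrite mulr_natl -sumr_const mulr_sumr mulr_sumr -sumrN -!big_split /=.
  by apply: eq_bigr => j _; ring.
by field.
Qed.

(** Each edge of the star is counted twice, once from each end. *)
Lemma sum_excess_gaps (R : realType) (n : nat) (x : 'I_n -> R) (c : 'I_n)
    (J := [set j | 1 < (x c - x j) ^+ 2]) :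
  (forall i j, 1 < (x i - x j) ^+ 2 -> (i == c) || (j == c)) ->
  \sum_i \sum_j excess ((x i - x j) ^+ 2) =
  2 * \sum_(j in J) ((x c - x j) ^+ 2 - 1).
Proof.
move=> star.
have centre j : c == j -> excess ((x c - x j) ^+ 2) = 0.
  by move/eqP<-; rewrite subrr expr0n excess_le1 ?ler01.
have toJ : \sum_j excess ((x c - x j) ^+ 2) = \sum_(j in J) ((x c - x j) ^+ 2 - 1).
  rewrite (bigID (mem J)) /= [X in _ + X]big1 ?addr0.
    by apply: eq_bigr => j; rewrite inE => /ltW; apply: excess_ge1.
  by move=> j; rewrite inE -leNgt; apply: excess_le1.
rewrite -toJ mulr2n mulrDl mul1r (bigD1 c) //=; congr (_ + _).
rewrite [RHS](bigD1 c) //= centre // add0r.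
apply: eq_bigr => i ic; rewrite (bigD1 c) //= big1 ?addr0 ?[in RHS]distrC.
  by rewrite -opprB sqrrN.
move=> j jc; apply: excess_le1; rewrite leNgt; apply/negP => /star.
by rewrite (negPf ic) (negPf jc).
Qed.

Lemma sum_sqr_star (R : realType) (n : nat) (x : 'I_n -> R) (c : 'I_n)
    (J : {set 'I_n}) : c \notin J ->
  \sum_i x i ^+ 2 = x c ^+ 2 + \sum_(j in J) x j ^+ 2
                   + \sum_(j | j \notin c |: J) x j ^+ 2.
Proof.
move=> cJ; rewrite (bigID (mem (c |: J))) /=; congr (_ + _).
by rewrite big_setU1.
Qed.

Lemma sum_excess_gaps_le2 (R : realType) (n : nat) (x : 'I_n -> R) :
  \sum_i x i ^+ 2 <= 1 -> \sum_i \sum_j excess ((x i - x j) ^+ 2) <= 2.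
Proof.
move=> x_le1.
case: (pickP [pred p : 'I_n * 'I_n | 1 < (x p.1 - x p.2) ^+ 2]) => [[i0 j0]|] /=.
  case/(large_gaps_star x_le1) => c star; rewrite (sum_excess_gaps star).
  set J := [set _ | _].
  rewrite -[leRHS]mulr1 ler_pM2l // -subr_ge0 star_gaps_defect.
  have cJ : c \notin J by rewrite inE subrr expr0n -leNgt ler01.
  apply: addr_ge0; last first.
    rewrite divr_ge0 //; apply: sumr_ge0 => i _; apply: sumr_ge0 => j _.
    exact: sqr_ge0.
  rewrite addr_ge0 ?sqr_ge0 //; apply: mulr_ge0; first by rewrite addr_ge0.
  rewrite subr_ge0 (le_trans _ x_le1) // (sum_sqr_star _ cJ) lerDl.
  by apply: sumr_ge0 => i _; apply: sqr_ge0.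
move=> no_gap; rewrite big1 // => i _; apply: big1 => j _.
by apply: excess_le1; rewrite leNgt; have := no_gap (i, j) => /= ->.
Qed.

(** The three nonnegative terms of [star_gaps_defect] vanish, together with the
    coordinates outside the star: the vector is the top eigenvector of the
    Laplacian of a star with centre [c] and leaves [J]. *)
Lemma sum_excess_gaps_eq2 (R : realType) (n : nat) (x : 'I_n -> R) :
  \sum_i x i ^+ 2 <= 1 -> \sum_i \sum_j excess ((x i - x j) ^+ 2) = 2 ->
  exists c (J : {set 'I_n}) (t : R),
    [/\ c \notin J, (0 < #|J|)%N, x c = - (#|J|%:R * t),
        forall j, j != c -> x j = if j \in J then t else 0
      & #|J|%:R * (#|J|%:R + 1) * t ^+ 2 = 1].
Proof.
move=> x_le1.
case: (pickP [pred p : 'I_n * 'I_n | 1 < (x p.1 - x p.2) ^+ 2]) => [[i0 j0]|] /=;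
    last first.
  move=> no_gap; rewrite big1 => [/eqP|i _]; first by rewrite eq_sym pnatr_eq0.
  apply: big1 => j _; apply: excess_le1.
  by rewrite leNgt; have := no_gap (i, j) => /= ->.
case/(large_gaps_star x_le1) => c star; rewrite (sum_excess_gaps star).
set J := [set _ | _] => sum2; exists c, J.
have cJ : c \notin J by rewrite inE subrr expr0n -leNgt ler01.
have sum1 : \sum_(j in J) ((x c - x j) ^+ 2 - 1) = 1 by lra.
have [j1 j1J|J0] := pickP (mem J); last first.
  by move: sum1; rewrite big_pred0 // => /eqP; rewrite eq_sym oner_eq0.
have gaps_ge0 i : 0 <= \sum_(j in J) (x i - x j) ^+ 2.
  by apply: sumr_ge0 => j _; apply: sqr_ge0.
have rest_ge0 : 0 <= \sum_(j | j \notin c |: J) x j ^+ 2.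
  by apply: sumr_ge0 => j _; apply: sqr_ge0.
have := star_gaps_defect J c x; rewrite sum1 subrr.
have := sum_sqr_star x cJ; set T := x c ^+ 2 + _ => eqT.
have T_le1 : 0 <= 1 - T by lra.
set s := _ ^+ 2; have s_ge0 : 0 <= s by apply: sqr_ge0.
set g := \sum_(i in J) _.
have g_ge0 : 0 <= g by apply: sumr_ge0 => i _; apply: gaps_ge0.
have k_ge0 : 0 <= #|J|%:R :> R by [].
move=> defect.
have [T1 s0 g0] : [/\ T = 1, s = 0 & g = 0] by split; nra.
have xJ j : j \in J -> x j = x j1.
  move=> jJ; apply/eqP; rewrite -subr_eq0 -sqrf_eq0; apply/eqP.
  have gj := psumr_eq0P (fun i _ => gaps_ge0 i) g0 jJ.
  exact: (psumr_eq0P (fun i _ => sqr_ge0 (x j - x i)) gj j1J).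
have xc : x c = - (#|J|%:R * x j1).
  move/eqP: s0; rewrite sqrf_eq0 addr_eq0 => /eqP ->.
  by rewrite (eq_bigr _ xJ) sumr_const mulr_natl.
exists (x j1); split=> //.
- by apply/card_gt0P; exists j1.
- move=> j jc; case: ifPn => [/xJ //|jJ].
  apply/eqP; rewrite -sqrf_eq0; apply/eqP.
  have rest0 : \sum_(j | j \notin c |: J) x j ^+ 2 = 0.
    by move: eqT x_le1 rest_ge0; rewrite T1 => ->; lra.
  apply: (psumr_eq0P (fun i _ => sqr_ge0 (x i)) rest0).
  by rewrite in_setU1 negb_or jc.
- have : x c ^+ 2 + #|J|%:R * x j1 ^+ 2 = 1.
    rewrite -[RHS]T1 /T; congr (_ + _); rewrite mulr_natl -sumr_const.
    by apply: eq_bigr => j /xJ ->.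
  by rewrite xc => E; rewrite -[RHS]E; ring.
Qed.

(** In the equality case no gap equals 1 outside the edges. The strict inequality
    forces the entries outside the star to vanish in [equality_configuration]. *)
Lemma star_gap_lt1 (R : realType) (n : nat) (x : 'I_n -> R) (c : 'I_n)
    (J : {set 'I_n}) (t : R) :
  (0 < #|J|)%N -> x c = - (#|J|%:R * t) ->
  (forall j, j != c -> x j = if j \in J then t else 0) ->
  #|J|%:R * (#|J|%:R + 1) * t ^+ 2 = 1 ->
  forall i j, ~~ ((i == c) && (j \in J)) -> ~~ ((j == c) && (i \in J)) ->
  (x i - x j) ^+ 2 < 1.
Proof.
move=> J_gt0 xc xJ norm1 i j.
have k_ge1 : 1 <= #|J|%:R :> R by rewrite ler1n.
have t2_gt0 : 0 < t ^+ 2.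
  rewrite lt_neqAle sqr_ge0 andbT eq_sym; apply: contra_eq_neq norm1 => ->.
  by rewrite mulr0 eq_sym oner_eq0.
have t2_lt1 : t ^+ 2 < 1 by nra.
have xc2_lt1 : x c ^+ 2 < 1 by rewrite xc sqrrN exprMn; nra.
have [-> | ic] := eqVneq i c; have [-> | jc] := eqVneq j c => //=.
- by rewrite subrr expr0n ltr01.
- by move=> /negPf jJ _; rewrite (xJ j) // jJ subr0.
- by move=> _ /negPf iJ; rewrite (xJ i) // iJ sub0r sqrrN.
by move=> _ _; rewrite !xJ //; do 2!case: ifP => _;
  rewrite ?subrr ?subr0 ?sub0r ?sqrrN ?expr0n ?ltr01.
Qed.

(** * Commutators with a diagonal matrix *)

Lemma commmx_diag (R : realType) (n : nat) (e : 'rV[R]_n) (Y : 'M[R]_n) i j :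
  commmx (diag_mx e) Y i j = (e 0 i - e 0 j) * Y i j.
Proof.
by rewrite /commmx mul_diag_mx mul_mx_diag !mxE mulrBl (mulrC (Y i j)).
Qed.

Lemma sqfrob_commmx_diag (R : realType) (n : nat) (e : 'rV[R]_n) (Y : 'M[R]_n) :
  sqfrob (commmx (diag_mx e) Y) =
  \sum_i \sum_j (e 0 i - e 0 j) ^+ 2 * Y i j ^+ 2.
Proof.
by apply: eq_bigr => i _; apply: eq_bigr => j _; rewrite commmx_diag exprMn.
Qed.

Lemma sqfrob_diag_mx (R : realType) (n : nat) (e : 'rV[R]_n) :
  sqfrob (diag_mx e) = \sum_i e 0 i ^+ 2.
Proof.
apply: eq_bigr => i _; rewrite (bigD1 i) //= big1 ?addr0; first by rewrite mxE eqxx.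
by move=> j ji; rewrite mxE eq_sym (negPf ji) expr0n.
Qed.

(** A zero matrix is allowed because the matrices of an orthogonal family are
    normalised uniformly, including those that vanish. *)
Definition orthonormal_or_zero (R : realType) (m n : nat)
    (Y : 'I_m -> 'M[R]_n) : Prop :=
  (forall s u, s != u -> frobdot (Y s) (Y u) = 0) /\
  (forall s, Y s = 0 \/ sqfrob (Y s) = 1).

(** Bessel's inequality for the matrix with entry 1/2 at [(i, j)] and [(j, i)].
    The combination [W] of the [Y s] with coefficients [Y s i j] has both entries
    [W i j] and [W j i] equal to the sum [w], so that [2 w^2 <= sqfrob W <= w]. *)
Lemma bessel_offdiag (R : realType) (m n : nat) (Y : 'I_m -> 'M[R]_n)
    (i j : 'I_n) :
  (forall s, (Y s)^T = Y s) -> orthonormal_or_zero Y -> i != j ->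
  \sum_s Y s i j ^+ 2 <= 2^-1.
Proof.
move=> symY [orthY normY] ij; set w := \sum_s _.
have w_ge0 : 0 <= w by apply: sumr_ge0 => s _; apply: sqr_ge0.
pose W := \sum_s Y s i j *: Y s.
have Wij : W i j = w.
  by rewrite summxE; apply: eq_bigr => s _; rewrite mxE expr2.
have Wji : W j i = w.
  rewrite -Wij -[in LHS](_ : W^T = W) ?mxE // linear_sum.
  by apply: eq_bigr => s _; rewrite linearZ /= symY.
have le_w : sqfrob W <= w.
  rewrite -frobdotxx frobdot_suml; apply: ler_sum => s _.
  rewrite frobdot_sumr (bigD1 s) //= big1 ?addr0; last first.
    by move=> u us; rewrite orthY ?mulr0 // eq_sym.
  rewrite mulrA -expr2 -[leRHS]mulr1 ler_wpM2l ?sqr_ge0 // frobdotxx.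
  case: (normY s) => [/eqP|->] //.
  by rewrite -sqfrob_eq0 => /eqP->; apply: ler01.
have ge_w : w ^+ 2 + w ^+ 2 <= sqfrob W.
  rewrite -{1}Wij -Wji /sqfrob pair_big /=.
  have uniq_ij : uniq [:: (i, j); (j, i)] by rewrite /= inE xpair_eqE negb_and ij.
  apply: le_trans (sum_uniq_le uniq_ij _) => [|p]; last exact: sqr_ge0.
  by rewrite !big_cons big_nil addr0.
have := le_trans ge_w le_w.
have [->|w_neq0] := eqVneq w 0; first by rewrite invr_ge0.
have w_gt0 : 0 < w by rewrite lt_neqAle eq_sym w_neq0.
by move=> w2; nra.
Qed.

(** With [sqfrob Y = 1], the number [sqfrob [diag e, Y] - 1] is the sum of the
    [((e_i - e_j)^2 - 1) Y_ij^2]. *)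
Lemma excess_commmx_diag_le (R : realType) (n : nat) (e : 'rV[R]_n)
    (Y : 'M[R]_n) :
  Y = 0 \/ sqfrob Y = 1 ->
  excess (sqfrob (commmx (diag_mx e) Y)) <=
  \sum_i \sum_j excess ((e 0 i - e 0 j) ^+ 2) * Y i j ^+ 2.
Proof.
have sum_ge0 : 0 <= \sum_i \sum_j excess ((e 0 i - e 0 j) ^+ 2) * Y i j ^+ 2.
  apply: sumr_ge0 => i _; apply: sumr_ge0 => j _.
  by rewrite mulr_ge0 ?excess_ge0 ?sqr_ge0.
move=> normY; rewrite {1}/excess ge_max sum_ge0 /= sqfrob_commmx_diag.
case: normY => [Y0 | normY].
  rewrite big1 ?sub0r; first by rewrite (le_trans _ sum_ge0) // oppr_le0.
  by move=> i _; apply: big1 => j _; rewrite Y0 mxE expr0n mulr0.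
rewrite -normY -sumrB; apply: ler_sum => i _; rewrite -sumrB; apply: ler_sum => j _.
by rewrite -{2}[Y i j ^+ 2]mul1r -mulrBl ler_wpM2r ?sqr_ge0 ?ge_excess.
Qed.

Lemma sum_weighted_gaps_le (R : realType) (m n : nat) (e : 'rV[R]_n)
    (Y : 'I_m -> 'M[R]_n) :
  (forall s, (Y s)^T = Y s) -> orthonormal_or_zero Y ->
  forall i j, excess ((e 0 i - e 0 j) ^+ 2) * \sum_s Y s i j ^+ 2 <=
              excess ((e 0 i - e 0 j) ^+ 2) * 2^-1.
Proof.
move=> symY onY i j; have [->|ij] := eqVneq i j.
  by rewrite subrr expr0n excess_le1 ?ler01 // !mul0r.
by rewrite ler_wpM2l ?excess_ge0 // bessel_offdiag.
Qed.

Lemma exchange_weighted_gaps (R : realType) (m n : nat) (d : 'I_n -> 'I_n -> R)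
    (Y : 'I_m -> 'M[R]_n) :
  \sum_s \sum_i \sum_j d i j * Y s i j ^+ 2 =
  \sum_i \sum_j d i j * \sum_s Y s i j ^+ 2.
Proof.
rewrite exchange_big; apply: eq_bigr => i _; rewrite exchange_big.
by apply: eq_bigr => j _; rewrite mulr_sumr.
Qed.

(** Bounding each excess by a weighted sum over the gaps and exchanging the sums,
    Bessel's inequality leaves half of the total excess of the gaps of [e]. *)
Lemma sum_excess_commmx_diag_le1 (R : realType) (m n : nat) (e : 'rV[R]_n)
    (Y : 'I_m -> 'M[R]_n) :
  (forall s, (Y s)^T = Y s) -> orthonormal_or_zero Y ->
  sqfrob (diag_mx e) <= 1 ->
  \sum_s excess (sqfrob (commmx (diag_mx e) (Y s))) <= 1.
Proof.
move=> symY onY; rewrite sqfrob_diag_mx => /sum_excess_gaps_le2 gaps_le2.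
apply: le_trans (ler_sum _ (fun s _ => excess_commmx_diag_le e (proj2 onY s))) _.
rewrite exchange_weighted_gaps.
have le2 : \sum_i \sum_j excess ((e 0 i - e 0 j) ^+ 2) * \sum_s Y s i j ^+ 2 <=
    \sum_i \sum_j excess ((e 0 i - e 0 j) ^+ 2) * 2^-1.
  by apply: ler_sum => i _; apply: ler_sum => j _; apply: sum_weighted_gaps_le.
apply: le_trans le2 _.
under eq_bigr do rewrite -mulr_suml.
by rewrite -mulr_suml; lra.
Qed.

Lemma sumr_eq_termwise (R : realType) (I : finType) (f g : I -> R) :
  (forall i, f i <= g i) -> \sum_i g i <= \sum_i f i -> forall i, f i = g i.
Proof.
move=> fg gf i; apply/eqP; rewrite eq_sym -subr_eq0; apply/eqP.
apply: (@psumr_eq0P _ _ predT (fun i => g i - f i)) => // [k _|].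
  by rewrite subr_ge0.
by apply/eqP; rewrite sumrB subr_eq0 eq_le gf ler_sum.
Qed.

(** When the bound is attained, every inequality of the chain above is an equality
    term by term. *)
Lemma sum_excess_commmx_diag_eq1 (R : realType) (m n : nat) (e : 'rV[R]_n)
    (Y : 'I_m -> 'M[R]_n) :
  (forall s, (Y s)^T = Y s) -> orthonormal_or_zero Y ->
  sqfrob (diag_mx e) <= 1 ->
  \sum_s excess (sqfrob (commmx (diag_mx e) (Y s))) = 1 ->
  [/\ \sum_i \sum_j excess ((e 0 i - e 0 j) ^+ 2) = 2,
      forall i j, 1 < (e 0 i - e 0 j) ^+ 2 -> \sum_s Y s i j ^+ 2 = 2^-1
    & forall s, excess (sqfrob (commmx (diag_mx e) (Y s))) =
        \sum_i \sum_j excess ((e 0 i - e 0 j) ^+ 2) * Y s i j ^+ 2].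
Proof.
move=> symY onY; rewrite sqfrob_diag_mx => /sum_excess_gaps_le2 gaps_le2 sum1.
have le1 s := excess_commmx_diag_le e (proj2 onY s).
have le2 := sum_weighted_gaps_le e symY onY.
have le3 i : \sum_j excess ((e 0 i - e 0 j) ^+ 2) * \sum_s Y s i j ^+ 2 <=
    \sum_j excess ((e 0 i - e 0 j) ^+ 2) * 2^-1.
  by apply: ler_sum => j _; apply: le2.
have := ler_sum (index_enum _) (P := predT) (fun s _ => le1 s).
rewrite sum1 exchange_weighted_gaps.
have := ler_sum (index_enum _) (P := predT) (fun i _ => le3 i).
have -> : \sum_i \sum_j excess ((e 0 i - e 0 j) ^+ 2) * 2^-1 =
    (\sum_i \sum_j excess ((e 0 i - e 0 j) ^+ 2)) / 2.
  by rewrite mulr_suml; apply: eq_bigr => i _; rewrite mulr_suml.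
move=> h1 h2; split; first by lra.
  move=> i j; rewrite -excess_gt0 => gap; apply: (mulfI (lt0r_neq0 gap)).
  apply: (sumr_eq_termwise (le2 i)); rewrite (sumr_eq_termwise le3) //.
  under eq_bigr do rewrite -mulr_suml.
  by rewrite -mulr_suml; lra.
by apply: sumr_eq_termwise => //; rewrite sum1 exchange_weighted_gaps; lra.
Qed.

(** The key estimate, reduced to a diagonal [A] by the spectral theorem. It means
    that the [k] largest eigenvalues of the square of [ad A] on symmetric matrices
    have sum at most [k + 1] when [sqfrob A <= 1]. *)
Lemma sum_excess_commmx_le1 (R : realType) (m n : nat) (A : 'M[R]_n)
    (Y : 'I_m -> 'M[R]_n) :
  A^T = A -> (forall s, (Y s)^T = Y s) -> orthonormal_or_zero Y ->
  sqfrob A <= 1 -> \sum_s excess (sqfrob (commmx A (Y s))) <= 1.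
Proof.
move=> symA symY onY; have [P [e [orthP eqA]]] := symmetricmx_spectral symA.
have [PPt PtP] := orthP.
have eqe : P^T *m A *m P = diag_mx e.
  by rewrite eqA !mulmxA PtP mul1mx -mulmxA PtP mulmx1.
rewrite -(sqfrob_conj _ orthP) eqe => norm_e.
under eq_bigr do rewrite -(sqfrob_commmx_conj _ _ orthP) eqe.
apply: sum_excess_commmx_diag_le1 => //.
  by move=> s; rewrite !trmx_mul trmxK symY mulmxA.
case: onY => orthY normY; split=> [s u su | s]; first by rewrite frobdot_conj ?orthY.
case: (normY s) => [->|<-]; first by left; rewrite mulmx0 mul0mx.
by right; rewrite sqfrob_conj.
Qed.

(** * Symmetric matrices supported on one row and column *)

Definition cross_mx (R : realType) (n : nat) (c : 'I_n) (p : 'rV[R]_n) : 'M[R]_n :=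
  (delta_mx 0 c)^T *m p + p^T *m delta_mx 0 c.

Lemma cross_mxE (R : realType) (n : nat) (c : 'I_n) (p : 'rV[R]_n) i j :
  cross_mx c p i j = (i == c)%:R * p 0 j + (j == c)%:R * p 0 i.
Proof. by rewrite !mxE !big_ord1 !mxE !eqxx /= (mulrC (p 0 i)). Qed.

Lemma cross_mx_row (R : realType) (n : nat) (c : 'I_n) (X : 'M[R]_n) :
  X^T = X -> (forall i j, ~~ ((i == c) (+) (j == c)) -> X i j = 0) ->
  X = cross_mx c (row c X).
Proof.
move=> symX X0; apply/matrixP => i j; rewrite cross_mxE !mxE.
have [-> | ic] := eqVneq i c; have [-> | jc] := eqVneq j c;
  rewrite ?mul1r ?mul0r ?addr0 ?add0r //.
- by rewrite X0 ?eqxx // addr0.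
- by rewrite -[in LHS]symX mxE.
by rewrite X0 // (negPf ic) (negPf jc).
Qed.

Lemma mul_delta_tr (R : realType) (n : nat) (c : 'I_n) (p : 'rV[R]_n) :
  p 0 c = 0 -> delta_mx 0 c *m p^T = 0 :> 'M_1.
Proof. by move=> pc; rewrite -rowE; apply/matrixP => i j; rewrite !ord1 !mxE. Qed.

Lemma mul_tr_delta (R : realType) (n : nat) (c : 'I_n) (p : 'rV[R]_n) :
  p 0 c = 0 -> p *m (delta_mx 0 c)^T = 0 :> 'M_1.
Proof. by move=> pc; rewrite -[LHS]trmxK trmx_mul trmxK mul_delta_tr ?trmx0. Qed.

(** With [p] and [q] orthogonal the product has rank at most one, which makes
    the commutator [p^T *m q - q^T *m p]. *)
Lemma mul_cross_mx (R : realType) (n : nat) (c : 'I_n) (p q : 'rV[R]_n) :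
  p 0 c = 0 -> q 0 c = 0 ->
  cross_mx c p *m cross_mx c q =
  (p *m q^T) 0 0 *: delta_mx c c + p^T *m q.
Proof.
move=> pc qc; rewrite /cross_mx mulmxDl !mulmxDr !mulmxA.
rewrite -(mulmxA _ p) mul_tr_delta // mulmx0 mul0mx add0r.
rewrite -(mulmxA _ p) -(mulmxA _ (delta_mx 0 c)) trmx_delta mul_delta_mx.
rewrite -(mulmxA p^T _ q^T) mul_delta_tr // mulmx0 mul0mx addr0.
congr (_ + _); last first.
  by rewrite [delta_mx 0 0]mx11_scalar mxE !eqxx mulmx1.
by rewrite {1}[p *m q^T]mx11_scalar mul_mx_scalar -scalemxAl mul_delta_mx.
Qed.

Lemma frobdot_cross_mx (R : realType) (n : nat) (c : 'I_n) (p q : 'rV[R]_n) :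
  p 0 c = 0 -> q 0 c = 0 ->
  frobdot (cross_mx c p) (cross_mx c q) = 2 * (p *m q^T) 0 0.
Proof.
move=> pc qc; rewrite frobdotE.
have -> : (cross_mx c q)^T = cross_mx c q.
  by rewrite linearD /= !trmx_mul !trmxK addrC.
rewrite mul_cross_mx // linearD linearZ /= mxtrace_mulC.
rewrite [X in _ * X](_ : _ = 1); last first.
  rewrite /mxtrace (bigD1 c) //= big1 ?addr0 ?mxE ?eqxx // => i ic.
  by rewrite mxE (negPf ic).
rewrite mulr1 /mxtrace big_ord1 mulr2n mulrDl mul1r; congr (_ + _).
by rewrite !mxE; apply: eq_bigr => i _; rewrite !mxE mulrC.
Qed.

(** For unit norms the value is 1/2, too small for two members of an extremal
    family, whose commutators all have squared norm at least 1. *)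
Lemma sqfrob_commmx_cross_mx (R : realType) (n : nat) (c : 'I_n) (p q : 'rV[R]_n) :
  p 0 c = 0 -> q 0 c = 0 -> frobdot (cross_mx c p) (cross_mx c q) = 0 ->
  sqfrob (commmx (cross_mx c p) (cross_mx c q)) =
  sqfrob (cross_mx c p) * sqfrob (cross_mx c q) / 2.
Proof.
move=> pc qc; rewrite -!frobdotxx !frobdot_cross_mx // => /eqP.
rewrite mulf_eq0 pnatr_eq0 /= => /eqP pq.
have qp : (q *m p^T) 0 0 = 0 by rewrite -[RHS]pq -[q *m p^T]trmxK trmx_mul trmxK mxE.
rewrite /commmx !mul_cross_mx // pq qp !scale0r !add0r frobdotE.
rewrite linearB /= !trmx_mul !trmxK mulmxBl !mulmxBr !mulmxA.
have dot (u v w z : 'rV[R]_n) : \tr (u^T *m v *m w^T *m z) =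
    (v *m w^T) 0 0 * (z *m u^T) 0 0.
  rewrite mxtrace_mulC !mulmxA -[_ *m v *m w^T]mulmxA /mxtrace big_ord1.
  by rewrite mxE big_ord1 mulrC.
by rewrite !linearB /= !dot pq qp; field.
Qed.

(** Equality in the row bound for [r] makes [e] a star vector and leaves the other
    [Y s] supported on the edges of the star. Two nonzero such [Y s] would have a
    commutator of squared norm 1/2, so there is only one. Each edge must
    carry half of the squared entries of the family, and the unit norm of [Y s]
    then allows a single edge. *)
Lemma equality_configuration (R : realType) (m n : nat) (Y : 'I_m -> 'M[R]_n)
    (r : 'I_m) (e : 'rV[R]_n) :
  (forall s, (Y s)^T = Y s) -> orthonormal_or_zero Y ->
  Y r = diag_mx e -> sqfrob (Y r) = 1 ->
  \sum_s excess (sqfrob (commmx (Y r) (Y s))) = 1 ->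
  (forall s u, s != u -> Y s != 0 -> Y u != 0 ->
     1 <= sqfrob (commmx (Y s) (Y u))) ->
  exists s (a b : 'I_n) (t : R),
    [/\ 1 < sqfrob (commmx (Y r) (Y s)), s != r,
        forall u, u != r -> u != s -> Y u = 0, a != b
      & Y s = t *: (delta_mx a b + delta_mx b a) /\
        Y r = t *: (delta_mx a a - delta_mx b b)].
Proof.
move=> symY onY Yr normr sum1 comm_ge1; have [orthY normY] := onY.
have norm_e : sqfrob (diag_mx e) = 1 by rewrite -Yr.
rewrite Yr in sum1.
have e_le1 : sqfrob (diag_mx e) <= 1 by rewrite norm_e.
have [gaps2 gapY excessY] := sum_excess_commmx_diag_eq1 symY onY e_le1 sum1.
have norm_e1 : \sum_i e 0 i ^+ 2 <= 1 by rewrite -sqfrob_diag_mx norm_e.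
have [c [J [t [cJ J_gt0 ec eJ norm_t]]]] := sum_excess_gaps_eq2 norm_e1 gaps2.
have small := star_gap_lt1 J_gt0 ec eJ norm_t.
have jc j : j \in J -> j != c by apply: contraTneq => ->.
(* Comparing term by term the two sums that agree in [excessY s], the weight
   [1 - (e_i - e_j)^2] of an entry outside the star is positive. *)
have Y0 s i j : s != r ->
    ~~ ((i == c) && (j \in J)) -> ~~ ((j == c) && (i \in J)) -> Y s i j = 0.
  move=> sr ij ji; have [->|Ys_neq0] := eqVneq (Y s) 0; first by rewrite mxE.
  have norms : sqfrob (Y s) = 1.
    by case: (normY s) => // Ys0; rewrite Ys0 eqxx in Ys_neq0.
  have Yr_neq0 : Y r != 0 by rewrite -sqfrob_eq0 normr oner_eq0.
  have rs : r != s by rewrite eq_sym.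
  have := excessY s; rewrite -Yr excess_ge1 ?comm_ge1 // Yr sqfrob_commmx_diag.
  rewrite -norms -sumrB => sumE.
  have termE k l : ((e 0 k - e 0 l) ^+ 2 - 1) * Y s k l ^+ 2 <=
      excess ((e 0 k - e 0 l) ^+ 2) * Y s k l ^+ 2.
    by rewrite ler_wpM2r ?sqr_ge0 ?ge_excess.
  have sumE' : \sum_k \sum_l excess ((e 0 k - e 0 l) ^+ 2) * Y s k l ^+ 2 =
      \sum_k \sum_l ((e 0 k - e 0 l) ^+ 2 - 1) * Y s k l ^+ 2.
    rewrite -sumE; apply: eq_bigr => k _; rewrite -sumrB; apply: eq_bigr => l _.
    by rewrite mulrBl mul1r.
  have rowE k := ler_sum (index_enum _) (P := predT) (fun l _ => termE k l).
  have rowi := sumr_eq_termwise rowE _ i.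
  have := sumr_eq_termwise (termE i) _ j; rewrite rowi ?sumE' // => /(_ (lexx _)).
  rewrite excess_le1 ?ltW ?small // mul0r => /eqP.
  by rewrite mulf_eq0 sqrf_eq0 subr_eq0 lt_eqF ?small //= => /eqP.
have crossY s : s != r -> Y s = cross_mx c (row c (Y s)).
  move=> sr; apply: cross_mx_row => // i j ij; apply: Y0 => //.
    by apply: contra ij => /andP[-> /jc/negPf->].
  by apply: contra ij => /andP[-> /jc/negPf->].
have rowc s : s != r -> row c (Y s) 0 c = 0.
  by move=> sr; rewrite mxE Y0 // (negPf cJ) andbF.
have unique s u : s != r -> u != r -> s != u -> Y s != 0 -> Y u = 0.
  move=> sr ur su Ys; apply/eqP; apply: contraT => Yu.
  have := comm_ge1 s u su Ys Yu; have := orthY s u su.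
  have nz v : Y v != 0 -> sqfrob (Y v) = 1.
    by case: (normY v) => // ->; rewrite eqxx.
  have := nz s Ys; have := nz u Yu.
  rewrite (crossY s sr) (crossY u ur) => nu ns ort.
  rewrite sqfrob_commmx_cross_mx ?rowc // nu ns; lra.
have frob0 : sqfrob (0 : 'M[R]_n) = 0 by apply/eqP; rewrite sqfrob_eq0.
have [s s_gt1] : exists s, 1 < sqfrob (commmx (Y r) (Y s)).
  case: (pickP (fun s => 1 < sqfrob (commmx (Y r) (Y s)))) => [s|none].
    by exists s.
  move/eqP: sum1; rewrite big1 ?(eq_sym 0) ?oner_eq0 // => s _.
  by rewrite -Yr excess_le1 // leNgt none.
have sr : s != r.
  by apply: contraTneq s_gt1 => ->; rewrite commmxx frob0 -leNgt ler01.
have Ys_neq0 : Y s != 0.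
  apply: contraTneq s_gt1 => ->.
  by rewrite /commmx mulmx0 mul0mx subrr frob0 -leNgt ler01.
have others u : u != r -> u != s -> Y u = 0.
  by move=> ur us; apply: (unique s) => //; rewrite eq_sym.
have norms : sqfrob (Y s) = 1.
  by case: (normY s) => // Ys0; rewrite Ys0 eqxx in Ys_neq0.
have k_ge1 : 1 <= #|J|%:R :> R by rewrite ler1n.
(* The diagonal [Y r] and the zero matrices contribute nothing off the diagonal. *)
have entry j : j \in J -> Y s c j ^+ 2 = 2^-1.
  move=> jJ; rewrite -(gapY c j).
    rewrite (bigD1 s) //= big1 ?addr0 // => u us.
    have [->|ur] := eqVneq u r; last by rewrite others // mxE expr0n.
    by rewrite Yr mxE eq_sym (negPf (jc j jJ)) expr0n.
  by rewrite ec eJ ?jc // jJ; nra.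
have J1 : #|J| = 1%N.
  apply/eqP; rewrite eqn_leq J_gt0 andbT -(ler_nat R).
  have : 2 * (row c (Y s) *m (row c (Y s))^T) 0 0 = 1.
    by rewrite -(@frobdot_cross_mx _ _ c) ?rowc // -crossY // frobdotxx.
  rewrite mxE (bigID (mem J)) /= [X in _ + X]big1 ?addr0; last first.
    move=> j jJ; rewrite !mxE Y0 ?mul0r ?(negPf jJ) ?andbF //.
    by rewrite (negPf cJ) andbF.
  rewrite (eq_bigr (fun=> 2^-1)).
    by rewrite sumr_const -[_^-1 *+ _]mulr_natl => ?; lra.
  by move=> j jJ; rewrite !mxE -expr2 entry.
have [b defJ] := cards1P (introT eqP J1).
have bc : b != c by apply: jc; rewrite defJ inE.
have bJ : b \in J by rewrite defJ inE.
have t2 : t ^+ 2 = Y s c b ^+ 2.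
  by rewrite entry //; move: norm_t; rewrite J1; lra.
have defYr : Y r = t *: (delta_mx b b - delta_mx c c).
  apply/matrixP => i j; rewrite Yr !mxE.
  have [<-|ij] := eqVneq i j; last first.
    have off d : (i == d) && (j == d) = false.
      by apply: contra_neqF ij => /andP[/eqP-> /eqP->].
    by rewrite !off subrr mulr0.
  rewrite !andbb mulr1n; have [->|ic] := eqVneq i c.
    by rewrite ec J1 eq_sym (negPf bc) mul1r sub0r mulrN mulr1.
  by rewrite eJ // defJ inE subr0; case: eqP; rewrite ?mulr1 ?mulr0.
have defYs : Y s = Y s c b *: (delta_mx b c + delta_mx c b).
  apply/matrixP => i j; rewrite [RHS]mxE !mxE.
  have [/andP[/eqP-> /eqP->] | ij] := boolP ((i == c) && (j == b)).
    by rewrite eq_sym (negPf bc) add0r mulr1.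
  have [/andP[/eqP-> /eqP->] | ji] := boolP ((i == b) && (j == c)).
    by rewrite addr0 mulr1 -[in LHS]symY mxE.
  by rewrite addr0 mulr0 Y0 // defJ inE // andbC.
(* The sign of [Y s c b] decides which endpoint of the edge comes first. *)
have := t2 => /eqP; rewrite eqf_sqr => /orP[/eqP eq_t | /eqP eq_t].
  by exists s, b, c, t; split=> //; rewrite {1}eq_t.
exists s, c, b, (- t); split; rewrite // 1?eq_sym //; split.
  by rewrite eq_t opprK [delta_mx c b + _]addrC.
by rewrite defYr scaleNr -scalerN opprB.
Qed.

(** * From the row bounds to the double sum *)

(** Here [x r] stands for the squared norm of the r-th matrix and [c r s] for the
    squared norm of the commutator of the normalised matrices. The cross terms
    [x r * x s] weighted by the excess are split by means of
    [2 x y = x^2 + y^2 - (x - y)^2], which turns a bound on the rows of the excess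
    into a bound on the double sum. *)
Lemma double_sum_defect (R : realType) (m : nat) (x : 'I_m -> R)
    (c : 'I_m -> 'I_m -> R) :
  (forall r, c r r = 0) -> (forall r s, c r s = c s r) ->
  (\sum_r x r) ^+ 2 - \sum_r \sum_s x r * x s * c r s =
  \sum_r \sum_(s | s != r) x r * x s * (1 + excess (c r s) - c r s)
  + \sum_r x r ^+ 2 * (1 - \sum_s excess (c r s))
  + (\sum_r \sum_s excess (c r s) * (x r - x s) ^+ 2) / 2.
Proof.
move=> crr csym.
have E0 : excess 0 = 0 :> R by rewrite excess_le1 ?ler01.
set D := \sum_r \sum_s excess (c r s) * x r ^+ 2.
set M := \sum_r \sum_s excess (c r s) * (x r * x s).
have -> : \sum_r \sum_s excess (c r s) * (x r - x s) ^+ 2 = 2 * (D - M).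
  have D' : D = \sum_r \sum_s excess (c r s) * x s ^+ 2.
    rewrite /D exchange_big; apply: eq_bigr => r _; apply: eq_bigr => s _.
    by rewrite csym.
  rewrite mulrBr {1}mulr2n [(1 + 1) * D]mulrDl mul1r {2}D' /D /M mulr_sumr.
  rewrite -big_split -sumrB; apply: eq_bigr => r _ /=.
  rewrite mulr_sumr -big_split -sumrB; apply: eq_bigr => s _ /=; ring.
have -> : \sum_r x r ^+ 2 * (1 - \sum_s excess (c r s)) = \sum_r x r ^+ 2 - D.
  rewrite -sumrB; apply: eq_bigr => r _; rewrite mulrBr mulr1 mulr_sumr.
  by congr (_ - _); apply: eq_bigr => s _; rewrite mulrC.
have -> : \sum_r \sum_(s | s != r) x r * x s * (1 + excess (c r s) - c r s) =
    (\sum_r x r) ^+ 2 + M - \sum_r \sum_s x r * x s * c r s - \sum_r x r ^+ 2.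
  rewrite expr2 mulr_suml -big_split -!sumrB; apply: eq_bigr => r _ /=.
  have -> : \sum_(s | s != r) x r * x s * (1 + excess (c r s) - c r s) =
      \sum_s x r * x s * (1 + excess (c r s) - c r s) - x r ^+ 2.
    rewrite [in RHS](bigD1 r) //= crr E0 addr0 subr0 mulr1 expr2.
    by rewrite addrAC subrr add0r.
  congr (_ - _).
  rewrite mulr_sumr -big_split -sumrB; apply: eq_bigr => s _ /=; ring.
by field.
Qed.

Lemma double_sum_defect_ge0 (R : realType) (m : nat) (x : 'I_m -> R)
    (c : 'I_m -> 'I_m -> R) :
  (forall r, 0 <= x r) -> (forall r, \sum_s excess (c r s) <= 1) ->
  [/\ forall r s, 0 <= x r * x s * (1 + excess (c r s) - c r s),
      forall r, 0 <= x r ^+ 2 * (1 - \sum_s excess (c r s))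
    & forall r s, 0 <= excess (c r s) * (x r - x s) ^+ 2].
Proof.
move=> x_ge0 row_le1; split=> [r s|r|r s].
- by rewrite !mulr_ge0 //; have := ge_excess (c r s); lra.
- by rewrite mulr_ge0 ?sqr_ge0 // subr_ge0.
by rewrite mulr_ge0 ?excess_ge0 ?sqr_ge0.
Qed.

Lemma double_sum_le (R : realType) (m : nat) (x : 'I_m -> R)
    (c : 'I_m -> 'I_m -> R) :
  (forall r, 0 <= x r) -> (forall r, c r r = 0) ->
  (forall r s, c r s = c s r) -> (forall r, \sum_s excess (c r s) <= 1) ->
  \sum_r \sum_s x r * x s * c r s <= (\sum_r x r) ^+ 2.
Proof.
move=> x_ge0 crr csym row_le1; rewrite -subr_ge0 double_sum_defect //.
have [off_ge0 row_ge0 gap_ge0] := double_sum_defect_ge0 x_ge0 row_le1.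
by apply: addr_ge0; [apply: addr_ge0|rewrite divr_ge0 //];
  apply: sumr_ge0 => r _ //; apply: sumr_ge0 => s _.
Qed.

Lemma double_sum_eq (R : realType) (m : nat) (x : 'I_m -> R)
    (c : 'I_m -> 'I_m -> R) :
  (forall r, 0 <= x r) -> (forall r, c r r = 0) ->
  (forall r s, c r s = c s r) -> (forall r, \sum_s excess (c r s) <= 1) ->
  \sum_r \sum_s x r * x s * c r s = (\sum_r x r) ^+ 2 ->
  forall r, x r != 0 ->
  [/\ \sum_s excess (c r s) = 1,
      forall s, s != r -> x s != 0 -> 1 <= c r s
    & forall s, 1 < c r s -> x s = x r].
Proof.
move=> x_ge0 crr csym row_le1 eq_sum r xr.
have [off_ge0 row_ge0 gap_ge0] := double_sum_defect_ge0 x_ge0 row_le1.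
have off_sum_ge0 u :=
  sumr_ge0 (index_enum _) (P := fun s => s != u) (fun s _ => off_ge0 u s).
have gap_sum_ge0 u := sumr_ge0 (index_enum _) (P := predT) (fun s _ => gap_ge0 u s).
have := double_sum_defect x crr csym; rewrite eq_sum subrr.
have := sumr_ge0 (index_enum _) (P := predT) (fun u _ => off_sum_ge0 u).
have := sumr_ge0 (index_enum _) (P := predT) (fun u _ => row_ge0 u).
have := sumr_ge0 (index_enum _) (P := predT) (fun u _ => gap_sum_ge0 u).
set offs := \sum_i _; set gaps := \sum_i _; set rows := \sum_i _.
move=> gaps_ge0 rows_ge0 offs_ge0 sum0.
have [offs0 rows0 gaps0] : [/\ offs = 0, rows = 0 & gaps = 0] by split; lra.
split.
- have /eqP := psumr_eq0P (fun u _ => row_ge0 u) rows0 (i := r) isT.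
  by rewrite mulf_eq0 sqrf_eq0 (negPf xr) subr_eq0 => /eqP.
- move=> s sr xs; have offr := psumr_eq0P (fun u _ => off_sum_ge0 u) offs0 (i := r) isT.
  have /eqP := psumr_eq0P (fun s _ => off_ge0 r s) offr sr.
  rewrite !mulf_eq0 (negPf xr) (negPf xs) /= => /eqP.
  by have := excess_ge0 (c r s); lra.
move=> s; rewrite -excess_gt0 => gap.
have gapr := psumr_eq0P (fun u _ => gap_sum_ge0 u) gaps0 (i := r) isT.
have /eqP := psumr_eq0P (fun s _ => gap_ge0 r s) gapr (i := s) isT.
by rewrite mulf_eq0 gt_eqF //= sqrf_eq0 subr_eq0 => /eqP.
Qed.

(** * Families orthogonal for the Frobenius product *)

Definition normalized (R : realType) (n : nat) (A : 'M[R]_n) : 'M[R]_n :=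
  (Num.sqrt (sqfrob A))^-1 *: A.

Lemma normalizedK (R : realType) (n : nat) (A : 'M[R]_n) :
  A = Num.sqrt (sqfrob A) *: normalized A.
Proof.
rewrite /normalized; have [->|A_neq0] := eqVneq A 0; first by rewrite !scaler0.
rewrite scalerA divff ?scale1r // gt_eqF // sqrtr_gt0.
by rewrite lt_neqAle sqfrob_ge0 eq_sym sqfrob_eq0 A_neq0.
Qed.

Lemma normalized_eq0 (R : realType) (n : nat) (A : 'M[R]_n) :
  (normalized A == 0) = (A == 0).
Proof.
apply/eqP/eqP => [N0|->]; last by rewrite /normalized scaler0.
by rewrite [A]normalizedK N0 scaler0.
Qed.

Lemma sqfrob_normalized (R : realType) (n : nat) (A : 'M[R]_n) :
  A != 0 -> sqfrob (normalized A) = 1.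
Proof.
move=> A_neq0; rewrite sqfrobZ exprVn sqr_sqrtr ?sqfrob_ge0 //.
by rewrite mulVf // sqfrob_eq0.
Qed.

Lemma normalized_tr (R : realType) (n : nat) (A : 'M[R]_n) :
  A^T = A -> (normalized A)^T = normalized A.
Proof. by move=> symA; rewrite linearZ /= symA. Qed.

(** The identity persists for zero matrices since [normalized 0 = 0]. *)
Lemma sqfrob_commmx_normalized (R : realType) (n : nat) (A B : 'M[R]_n) :
  sqfrob (commmx A B) =
  sqfrob A * sqfrob B * sqfrob (commmx (normalized A) (normalized B)).
Proof.
rewrite {1}[A]normalizedK {1}[B]normalizedK commmxZ sqfrobZ exprMn.
by rewrite !sqr_sqrtr ?sqfrob_ge0.
Qed.

Lemma orthonormal_or_zero_normalized (R : realType) (m n : nat)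
    (B : 'I_m -> 'M[R]_n) :
  (forall r s, r != s -> frobdot (B r) (B s) = 0) ->
  orthonormal_or_zero (fun r => normalized (B r)).
Proof.
move=> orthB; split=> [s u su | s]; first by rewrite frobdotZ orthB // mulr0.
have [->|Bs] := eqVneq (B s) 0; first by left; apply: scaler0.
by right; apply: sqfrob_normalized.
Qed.

Lemma sum_excess_normalized_le1 (R : realType) (m n : nat)
    (B : 'I_m -> 'M[R]_n) :
  (forall r, (B r)^T = B r) ->
  (forall r s, r != s -> frobdot (B r) (B s) = 0) ->
  forall r,
    \sum_s excess (sqfrob (commmx (normalized (B r)) (normalized (B s)))) <= 1.
Proof.
move=> symB orthB r; have onY := orthonormal_or_zero_normalized orthB.
apply: sum_excess_commmx_le1 => //.
- exact: normalized_tr.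
- by move=> s; apply: normalized_tr.
case: (proj2 onY r) => [Y0|->] //.
have /eqP -> : sqfrob (normalized (B r)) == 0 by rewrite sqfrob_eq0 Y0.
exact: ler01.
Qed.

Lemma sum_sqfrob_commmx_orthogonal_le (R : realType) (m n : nat)
    (B : 'I_m -> 'M[R]_n) :
  (forall r, (B r)^T = B r) ->
  (forall r s, r != s -> frobdot (B r) (B s) = 0) ->
  \sum_r \sum_s sqfrob (commmx (B r) (B s)) <= (\sum_r sqfrob (B r)) ^+ 2.
Proof.
move=> symB orthB.
under eq_bigr => r _ do under eq_bigr => s _ do rewrite sqfrob_commmx_normalized.
apply: double_sum_le => [r | r | r s | r]; first exact: sqfrob_ge0.
- by apply/eqP; rewrite commmxx sqfrob_eq0.
- exact: sqfrob_commmxC.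
exact: sum_excess_normalized_le1.
Qed.

(** Equality in the double sum gives equality in every row of a nonzero matrix, so
    [equality_configuration] applies after diagonalising [normalized (B r)]. The
    commutator of the two remaining normalised matrices exceeds 1, which forces
    their norms to agree: hence a common [mu]. *)
Lemma sum_sqfrob_commmx_orthogonal_eq (R : realType) (m n : nat)
    (B : 'I_m -> 'M[R]_n) (r : 'I_m) :
  (forall r, (B r)^T = B r) ->
  (forall r s, r != s -> frobdot (B r) (B s) = 0) ->
  \sum_r \sum_s sqfrob (commmx (B r) (B s)) = (\sum_r sqfrob (B r)) ^+ 2 ->
  B r != 0 ->
  exists s (P : 'M[R]_n) (a b : 'I_n) (mu : R),
    [/\ orthogonal_mx P, s != r, forall u, u != r -> u != s -> B u = 0, a != b
      & B s = P *m (mu *: (delta_mx a b + delta_mx b a)) *m P^T /\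
        B r = P *m (mu *: (delta_mx a a - delta_mx b b)) *m P^T].
Proof.
move=> symB orthB.
under eq_bigr => u _ do under eq_bigr => s _ do rewrite sqfrob_commmx_normalized.
move=> eq_sum Br; pose Y s := normalized (B s).
have [orthY normY] := orthonormal_or_zero_normalized orthB.
have eq_cases := double_sum_eq (fun r => sqfrob_ge0 (B r))
  (c := fun r s => sqfrob (commmx (Y r) (Y s))) _ _
  (sum_excess_normalized_le1 symB orthB) eq_sum.
have {eq_cases}eq_cases u : B u != 0 ->
  [/\ \sum_s excess (sqfrob (commmx (Y u) (Y s))) = 1,
      forall s, s != u -> B s != 0 -> 1 <= sqfrob (commmx (Y u) (Y s))
    & forall s, 1 < sqfrob (commmx (Y u) (Y s)) -> sqfrob (B s) = sqfrob (B u)].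
  rewrite -sqfrob_eq0 => Bu; case: (eq_cases _ _ u Bu) => [v | v w | sum1 ge1 eq_norm].
  - by apply/eqP; rewrite commmxx sqfrob_eq0.
  - exact: sqfrob_commmxC.
  by split=> // s su; rewrite -sqfrob_eq0; apply: ge1.
have [P [e [orthP eqY]]] := symmetricmx_spectral (normalized_tr (symB r)).
have [PPt PtP] := orthP.
pose Z s := P^T *m Y s *m P.
have YE s : Y s = P *m Z s *m P^T by rewrite /Z !mulmxA PPt mul1mx -mulmxA PPt mulmx1.
have Zr : Z r = diag_mx e.
  by rewrite /Z [Y r]eqY !mulmxA PtP mul1mx -mulmxA PtP mulmx1.
have Z_neq0 s : Z s != 0 -> B s != 0.
  by rewrite -normalized_eq0; apply: contra_neq => Y0; rewrite /Z [Y s]Y0 mulmx0 mul0mx.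
have [s [a [b [t [gap sr others ab [Zs Zr']]]]]] : exists s (a b : 'I_n) (t : R),
    [/\ 1 < sqfrob (commmx (Z r) (Z s)), s != r,
        forall u, u != r -> u != s -> Z u = 0, a != b
      & Z s = t *: (delta_mx a b + delta_mx b a) /\
        Z r = t *: (delta_mx a a - delta_mx b b)].
  apply: (equality_configuration (e := e)) => //.
  - by move=> s; rewrite /Z !trmx_mul trmxK normalized_tr // mulmxA.
  - split=> [s u su | s]; first by rewrite frobdot_conj ?orthY.
    case: (normY s) => [Y0|Y1]; last by right; rewrite sqfrob_conj.
    by left; rewrite /Z [Y s]Y0 mulmx0 mul0mx.
  - by rewrite sqfrob_conj // sqfrob_normalized.
  - under eq_bigr do rewrite sqfrob_commmx_conj //.
    by case: (eq_cases r Br).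
  move=> s u su /Z_neq0 Bs /Z_neq0 Bu; rewrite sqfrob_commmx_conj //.
  by case: (eq_cases s Bs) => _ ge1 _; apply: ge1; rewrite // eq_sym.
rewrite sqfrob_commmx_conj // in gap.
have norm_s : sqfrob (B s) = sqfrob (B r).
  by case: (eq_cases r Br) => _ _; apply.
exists s, P, a, b, (Num.sqrt (sqfrob (B r)) * t); split=> //.
  move=> u ur us; apply/eqP; rewrite -normalized_eq0 -/(Y u) YE others //.
  by rewrite mulmx0 mul0mx.
rewrite -!scalerA -Zs -Zr' -!scalemxAr -!scalemxAl -!YE; split; last exact: normalizedK.
by rewrite -norm_s; apply: normalizedK.
Qed.

(** * The extremal pair *)

Lemma offdiag_blockE (R : realType) (n : nat) (mu : R) (i0 i1 : 'I_n) :
  i0 = 0%N :> nat -> i1 = 1%N :> nat ->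
  offdiag_block n mu = mu *: (delta_mx i0 i1 + delta_mx i1 i0).
Proof.
move=> E0 E1; apply/matrixP => i j; rewrite !mxE -!val_eqE /= E0 E1.
by case: i j => [[|[|i]] ?] [[|[|j]] ?] /=; rewrite ?addr0 ?add0r ?mulr1 ?mulr0.
Qed.

Lemma diag_blockE (R : realType) (n : nat) (mu : R) (i0 i1 : 'I_n) :
  i0 = 0%N :> nat -> i1 = 1%N :> nat ->
  diag_block n mu = mu *: (delta_mx i0 i0 - delta_mx i1 i1).
Proof.
move=> E0 E1; apply/matrixP => i j; rewrite !mxE -!val_eqE /= E0 E1.
by case: i j => [[|[|i]] ?] [[|[|j]] ?] /=;
  rewrite ?subr0 ?sub0r ?mulrN ?mulr1 ?mulr0 ?oppr0.
Qed.

Lemma sqfrob_delta2 (R : realType) (n : nat) (u v : R) (a b c d : 'I_n) :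
  (a, b) != (c, d) ->
  sqfrob (u *: delta_mx a b + v *: delta_mx c d) = u ^+ 2 + v ^+ 2.
Proof.
move=> neq; have frob_delta i j k l :
    frobdot (delta_mx i j : 'M[R]_n) (delta_mx k l) = ((i, j) == (k, l))%:R.
  rewrite frobdotE trmx_delta.
  have [<-|jl] := eqVneq j l; last first.
    by rewrite mul_delta_mx_0 // mxtrace0 xpair_eqE (negPf jl) andbF.
  rewrite mul_delta_mx xpair_eqE eqxx andbT /mxtrace (bigD1 i) //= big1 ?addr0.
    by rewrite mxE eqxx.
  by move=> p pi; rewrite mxE (negPf pi).
rewrite -frobdotxx !frobdotE linearD /= mulmxDl !mulmxDr !linearD /= -!frobdotE.
by rewrite !frobdotZ !frob_delta !eqxx ![(c, d) == _]eq_sym (negPf neq) /=; ring.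
Qed.

Lemma commmx_offdiag_diag (R : realType) (n : nat) (mu : R) (a b : 'I_n) :
  a != b ->
  commmx (mu *: (delta_mx a b + delta_mx b a))
         (mu *: (delta_mx a a - delta_mx b b)) =
  (- (2 * mu ^+ 2)) *: delta_mx a b + (2 * mu ^+ 2) *: delta_mx b a.
Proof.
move=> ab; have ba : b != a by rewrite eq_sym.
rewrite commmxZ /commmx mulmxDl !mulmxBr !mulmxDr !mulmxBl !mul_delta_mx_cond.
rewrite !eqxx (negPf ab) (negPf ba) !mulr1n !mulr0n.
by apply/matrixP => i j; rewrite !mxE; ring.
Qed.

Lemma equality_of_extremal_pair (R : realType) (m n : nat) (B : 'I_m -> 'M[R]_n)
    (p q : 'I_m) (P : 'M[R]_n) (mu : R) (a b : 'I_n) :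
  orthogonal_mx P -> p != q -> a != b ->
  (forall r, r != p -> r != q -> B r = 0) ->
  B p = P *m (mu *: (delta_mx a b + delta_mx b a)) *m P^T ->
  B q = P *m (mu *: (delta_mx a a - delta_mx b b)) *m P^T ->
  \sum_r \sum_s sqfrob (commmx (B r) (B s)) = (\sum_r sqfrob (B r)) ^+ 2.
Proof.
move=> orthP pq ab B0 Bp Bq; have qp : q != p by rewrite eq_sym.
have orthPt : orthogonal_mx P^T by case: orthP; split; rewrite trmxK.
have frob0 : sqfrob (0 : 'M[R]_n) = 0 by apply/eqP; rewrite sqfrob_eq0.
have sum2 (f : 'I_m -> R) :
    (forall r, r != p -> r != q -> f r = 0) -> \sum_r f r = f p + f q.
  move=> f0; rewrite (bigD1 p) //= (bigD1 q) //= big1 ?addr0 //.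
  by move=> r /andP[]; apply: f0.
have np : sqfrob (B p) = 2 * mu ^+ 2.
  rewrite Bp -{1}[P]trmxK sqfrob_conj // scalerDr sqfrob_delta2; first by ring.
  by rewrite xpair_eqE negb_and ab.
have nq : sqfrob (B q) = 2 * mu ^+ 2.
  rewrite Bq -{1}[P]trmxK sqfrob_conj // scalerBr -scaleNr sqfrob_delta2.
    by ring.
  by rewrite xpair_eqE negb_and ab.
have npq : sqfrob (commmx (B p) (B q)) = 8 * mu ^+ 4.
  rewrite Bp Bq -{1 3}[P]trmxK sqfrob_commmx_conj // commmx_offdiag_diag //.
  rewrite sqfrob_delta2; first by ring.
  by rewrite xpair_eqE negb_and ab.
rewrite [\sum_r sqfrob _]sum2 => [|r rp rq]; last by rewrite B0.
rewrite sum2 => [|r rp rq]; last first.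
  by apply: big1 => s _; rewrite B0 // /commmx mul0mx mulmx0 subrr.
rewrite !sum2; first last.
- by move=> r rp rq; rewrite (B0 r) // /commmx mul0mx mulmx0 subrr.
- by move=> r rp rq; rewrite (B0 r) // /commmx mul0mx mulmx0 subrr.
rewrite !commmxx frob0 [sqfrob (commmx (B q) _)]sqfrob_commmxC npq np nq; ring.
Qed.

Lemma orthogonal_perm_mx (R : realType) (n : nat) (s : 'S_n) :
  orthogonal_mx (perm_mx s : 'M[R]_n).
Proof. by apply: orthogonal_mxP; rewrite tr_perm_mx -perm_mxM mulgV perm_mx1. Qed.

Lemma perm_mx_delta (R : realType) (n : nat) (s : 'S_n) (i j : 'I_n) :
  perm_mx s *m delta_mx (s i) (s j) *m (perm_mx s)^T =
  delta_mx i j :> 'M[R]_n.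
Proof.
rewrite tr_perm_mx -row_permE -col_permE; apply/matrixP => k l.
by rewrite !mxE !(inj_eq perm_inj).
Qed.

Lemma perm_two_points (n : nat) (a b i0 i1 : 'I_n) :
  a != b -> i0 != i1 -> exists s : 'S_n, s a = i0 /\ s b = i1.
Proof.
move=> ab i01; exists (tperm a i0 * tperm (tperm a i0 b) i1)%g.
have bi0 : tperm a i0 b != i0.
  by rewrite -{2}(tpermL a i0) (inj_eq perm_inj) eq_sym.
by rewrite !permM !tpermL (tpermD bi0) 1?eq_sym.
Qed.

Lemma orthogonal_mx_mul (R : realType) (n : nat) (P Q : 'M[R]_n) :
  orthogonal_mx P -> orthogonal_mx Q -> orthogonal_mx (P *m Q).
Proof.
move=> [PPt _] [QQt _]; apply: orthogonal_mxP.
by rewrite trmx_mul mulmxA -(mulmxA P) QQt mulmx1.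
Qed.

(** A permutation matrix moves the plane of the coordinates [a], [b] to that of
    the first two coordinates. *)
Lemma extremal_pair_blocks (R : realType) (n : nat) (P : 'M[R]_n) (a b : 'I_n) :
  orthogonal_mx P -> a != b ->
  exists2 P', orthogonal_mx P' & forall mu : R,
    P *m (mu *: (delta_mx a b + delta_mx b a)) *m P^T =
      P' *m offdiag_block n mu *m P'^T /\
    P *m (mu *: (delta_mx a a - delta_mx b b)) *m P^T =
      P' *m diag_block n mu *m P'^T.
Proof.
move=> orthP ab.
have n_gt1 : (1 < n)%N.
  have := card_ord n; rewrite (cardD1 a) (cardD1 b) !inE eq_sym ab /= => <-.
  by rewrite addnA leq_addr.
pose i0 := Ordinal (ltnW n_gt1); pose i1 := Ordinal n_gt1.
have [s [sa sb]] := perm_two_points ab (isT : i0 != i1).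
exists (P *m perm_mx s).
  exact: orthogonal_mx_mul orthP (orthogonal_perm_mx _ s).
move=> mu; rewrite (@offdiag_blockE _ _ _ i0 i1) // (@diag_blockE _ _ _ i0 i1) //.
have conj X Y : perm_mx s *m Y *m (perm_mx s)^T = X ->
    P *m (mu *: X) *m P^T =
    P *m perm_mx s *m (mu *: Y) *m (P *m perm_mx s)^T.
  by move=> <-; rewrite trmx_mul -!scalemxAr -!scalemxAl !mulmxA.
rewrite -sa -sb; split; apply: conj.
  by rewrite mulmxDr mulmxDl !perm_mx_delta.
by rewrite mulmxBr mulmxBl !perm_mx_delta.
Qed.

Theorem theorem1p1 (R : realType) (m n : nat) (B : 'I_m -> 'M[R]_n)
    (symB : forall r : 'I_m, B r \is symmetricmx) :
  (\sum_(r < m) \sum_(s < m) sqfrob (commmx (B r) (B s))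
     <= (\sum_(r < m) sqfrob (B r)) ^+ 2)
  /\
  ((2 <= m)%N -> (2 <= n)%N ->
   (\sum_(r < m) \sum_(s < m) sqfrob (commmx (B r) (B s))
      = (\sum_(r < m) sqfrob (B r)) ^+ 2
    <->
    exists Q : 'M[R]_m, orthogonal_mx Q /\
    exists p q : 'I_m,
      [/\ p != q,
          forall r : 'I_m, r != p -> r != q -> rotated Q B r = 0
        & exists (P : 'M[R]_n) (mu : R),
            [/\ orthogonal_mx P,
                rotated Q B p = P *m offdiag_block n mu *m P^T
              & rotated Q B q = P *m diag_block n mu *m P^T]])).
Proof.
have trB r : (B r)^T = B r by apply: symmetricmx_tr.
have [Q orthQ orthB] := rotated_orthogonal B.
have symQB := rotated_tr Q trB.
split=> [|m_gt1 n_gt1].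
  rewrite -(sum_sqfrob_commmx_rotated _ orthQ) -(sum_sqfrob_rotated _ orthQ).
  exact: sum_sqfrob_commmx_orthogonal_le.
split=> [|[Q' [orthQ' [p [q [pq rot0 [P [mu [orthP rotp rotq]]]]]]]]]; last first.
  rewrite -(sum_sqfrob_commmx_rotated _ orthQ') -(sum_sqfrob_rotated _ orthQ').
  pose i0 := Ordinal (ltnW n_gt1); pose i1 := Ordinal n_gt1.
  apply: (equality_of_extremal_pair orthP pq (isT : i0 != i1)) => //.
    by rewrite rotp (@offdiag_blockE _ _ _ i0 i1).
  by rewrite rotq (@diag_blockE _ _ _ i0 i1).
rewrite -(sum_sqfrob_commmx_rotated _ orthQ) -(sum_sqfrob_rotated _ orthQ).
move=> eq_sum; exists Q; split=> //.
case: (pickP (fun r => rotated Q B r != 0)) => [r Br|QB0]; last first.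
  exists (Ordinal (ltnW m_gt1)), (Ordinal m_gt1); split=> //.
    by move=> r _ _; apply/eqP; rewrite -[_ == _]negbK QB0.
  exists 1%:M, 0; split; first by apply: orthogonal_mxP; rewrite trmx1 mulmx1.
    rewrite (@offdiag_blockE _ _ _ (Ordinal (ltnW n_gt1)) (Ordinal n_gt1)) //.
    by rewrite scale0r mulmx0 mul0mx; apply/eqP; rewrite -[_ == _]negbK QB0.
  rewrite (@diag_blockE _ _ _ (Ordinal (ltnW n_gt1)) (Ordinal n_gt1)) //.
  by rewrite scale0r mulmx0 mul0mx; apply/eqP; rewrite -[_ == _]negbK QB0.
have [s [P [a [b [mu [orthP sr others ab [Bs Brr]]]]]]] :=
  sum_sqfrob_commmx_orthogonal_eq symQB orthB eq_sum Br.
have [P' orthP' blocks] := extremal_pair_blocks orthP ab.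
have [offE diagE] := blocks mu.
exists s, r; split=> // [u us ur|]; first exact: others.
by exists P', mu; split; rewrite // -?offE -?diagE.
Qed.
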